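(* Let $m,\alpha,\beta$ be positive integers. (a) Let $F_1\in \mathrm{Char}(m,\alpha)$ and $F_2\in \mathrm{Char}(m,\beta)$. Then the pointwise direct sum $F_1\oplus F_2$, $(F_1\oplus F_2)(S)=\begin{pmatrix}F_1(S)&0\\0&F_2(S)\end{pmatrix}$, belongs to $\mathrm{Char}(m,\alpha+\beta)$. (b) Suppose $F\in \mathrm{Char}(m,\alpha+\beta)$ admits a decomposition into a pointwise direct sum $F=F_1\oplus F_2$, where $F_1\in \mathrm{Inn}(m,\alpha)$ and $F_2\in \mathrm{Inn}(m,\beta)$. Then $F_1\in \mathrm{Char}(m,\alpha)$ and $F_2\in \mathrm{Char}(m,\beta)$.
   Context: $\mathrm{U}(n)$ is the group of unitary $n\times n$ matrices and $1_n$ the unit matrix of order $n$. $\mathrm{B}_n$ is the set of complex $n\times n$ matrices $z$ with Euclidean operator norm $\|z\|<1$, and $\overline{\mathrm{B}}_n$ is the set of those with $\|z\|\le 1$. $\mathrm{Inn}(m,\alpha)$ is the set of rational inner maps: maps $F$ whose matrix entries are rational functions of the matrix entries of $S$, which are holomorphic on $\mathrm{B}_m$ with $F(\mathrm{B}_m)\subset\overline{\mathrm{B}}_\alpha$, and whose values on $\mathrm{U}(m)$ (defined almost everywhere) lie in $\mathrm{U}(\alpha)$. Characteristic functions: for an integer $j\ge 0$, let $g=\begin{pmatrix}a&b\\c&d\end{pmatrix}\in \mathrm{U}(\alpha+mj)$, with $a$ of size $\alpha\times\alpha$ and $d$ of size $mj\times mj$. For $S=(s_{\mu\nu})\in \mathrm{B}_m$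 let $1_j\otimes S$ denote the $mj\times mj$ block matrix with $m\times m$ blocks, whose $(\mu,\nu)$ block is $s_{\mu\nu}1_j$. Put $$\Theta[g;S]=a+b\,(1_j\otimes S)\bigl(1_{mj}-d\,(1_j\otimes S)\bigr)^{-1}c .$$ (For $j=0$ this is the constant $a$.) $\mathrm{Char}(m,\alpha)$ is the set of all functions $S\mapsto \Theta[g;S]$, where $g\in \mathrm{U}(\alpha+mj)$ and $j=0,1,2,\dots$. It is known that $\mathrm{Char}(m,\alpha)\subset \mathrm{Inn}(m,\alpha)$. *)

(* Defs.v *)
From HB Require Import structures.
From mathcomp Require Import all_boot all_order all_algebra.
From mathcomp Require Import spectral mxtens complex.
From mathcomp Require Import -(notations) mpoly.
From mathcomp Require Import all_classical all_reals all_analysis.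

Set Implicit Arguments.
Unset Strict Implicit.
Unset Printing Implicit Defensive.

Import Order.TTheory GRing.Theory Num.Theory.
Import numFieldNormedType.Exports.

Local Open Scope classical_set_scope.
Local Open Scope ring_scope.
Local Open Scope complex_scope.

Definition enorm (R : realType) (n : nat) (x : 'cV[R[i]]_n) : R :=
  Num.sqrt (\sum_i (Normc.normc (x i 0) : R) ^+ 2).

(* The norm that MathComp-Analysis puts on matrices is the max norm of the
   entries; it induces the same topology, but it is not the operator norm. *)
Definition opnorm (R : realType) (n : nat) (z : 'M[R[i]]_n) : R :=
  sup [set enorm (z *m x) | x in [set x : 'cV[R[i]]_n | enorm x <= 1]].

Definition oball (R : realType) (n : nat) : set 'M[R[i]]_n :=
  [set z | opnorm z < 1].

Definition cball (R : realType) (n : nat) : set 'M[R[i]]_n :=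
  [set z | opnorm z <= 1].

Definition unitary_group (R : realType) (n : nat) : set 'M[R[i]]_n :=
  [set z | z \is unitarymx].

Definition entry_mpoly (R : realType) (m : nat) := mpoly.mpoly (m * m) R[i].

Definition eval_entries (R : realType) (m : nat)
    (p : entry_mpoly R m) (S : 'M[R[i]]_m) : R[i] :=
  mpoly.meval (fun k => mxvec S 0 k) p.

(* Maps on B_m are represented by total functions on 'M_m; only their values
   on oball matter in [Inn], [Char] below. *)

Definition rational_by (R : realType) (m alpha : nat)
    (F : 'M[R[i]]_m -> 'M[R[i]]_alpha)
    (P Q : 'I_alpha -> 'I_alpha -> entry_mpoly R m) : Prop :=
  (forall i j, Q i j != 0) /\
  (forall S, oball S -> forall i j,
     eval_entries (Q i j) S != 0 ->
     F S i j = eval_entries (P i j) S / eval_entries (Q i j) S).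

(* Complex (Frechet) differentiability; stated over an abstract field because
   the topology of MathComp-Analysis is attached to [numFieldType], and is not
   found by inference on the concrete type R[i]. *)
Definition holomorphic_on (K : numFieldType) (m n : nat) (D : set 'M[K]_m)
    (F : 'M[K]_m -> 'M[K]_n) : Prop :=
  forall S, D S -> differentiable F S.

Definition Inn (R : realType) (m alpha : nat)
    (F : 'M[R[i]]_m -> 'M[R[i]]_alpha) : Prop :=
  [/\ @holomorphic_on R[i] m alpha (@oball R m) F,
      (forall S, oball S -> cball (F S))
    & exists P Q : 'I_alpha -> 'I_alpha -> entry_mpoly R m,
        rational_by F P Q /\
        (* A nonzero polynomial does not vanish identically on U(m), which is
           Zariski dense in 'M_m, so this constrains almost all of U(m). *)
        (forall S, unitary_group S ->
           (forall i j, eval_entries (Q i j) S != 0) ->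
           unitary_group (\matrix_(i, j)
                (eval_entries (P i j) S / eval_entries (Q i j) S)))].

(* [S *t 1%:M] is the m x m block matrix with (mu, nu) block s_{mu nu} 1_j,
   which is written 1_j (x) S in the source.  For g unitary and S in oball the
   inverted matrix is invertible, so [invmx] is the actual inverse. *)
Definition Theta (R : realType) (m alpha j : nat)
    (g : 'M[R[i]]_(alpha + m * j)) (S : 'M[R[i]]_m) : 'M[R[i]]_alpha :=
  let a := ulsubmx g in
  let b := ursubmx g in
  let c := dlsubmx g in
  let d := drsubmx g in
  let T : 'M[R[i]]_(m * j) := S *t (1%:M : 'M[R[i]]_j) in
  a + b *m T *m invmx (1%:M - d *m T) *m c.

Definition Char (R : realType) (m alpha : nat)
    (F : 'M[R[i]]_m -> 'M[R[i]]_alpha) : Prop :=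
  exists (j : nat) (g : 'M[R[i]]_(alpha + m * j)),
    unitary_group g /\ (forall S, oball S -> F S = Theta g S).

Definition dsum (R : realType) (m alpha beta : nat)
    (F1 : 'M[R[i]]_m -> 'M[R[i]]_alpha) (F2 : 'M[R[i]]_m -> 'M[R[i]]_beta)
    (S : 'M[R[i]]_m) : 'M[R[i]]_(alpha + beta) :=
  block_mx (F1 S) 0 0 (F2 S).

(* Main.v *)
Require Import Defs.
From mathcomp Require Import all_boot all_order all_algebra.
From mathcomp Require Import spectral mxtens complex.
From mathcomp Require Import all_classical all_reals all_analysis.

(** Write T for S (x) 1_j. For S in the open ball, the value of a
characteristic function is determined by a feedback loop: [Theta g S] is the
only Y for which some X satisfies

    g (1 ; T X) = (Y ; X),

where (_ ; _) stacks blocks ([Theta_graph_ex], [Theta_graph_eq]). The loop can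
be solved because [1 - d T] is invertible: d is a block of a unitary matrix,
hence a contraction, and the norm of T is at most that of S, which is less than
1 ([unitmx_feedback]). Both parts of the theorem amount to finding a new unitary
matrix that realizes a given loop.

Direct sums. Given g1 and g2 with states C^m (x) C^j1 and C^m (x) C^j2, split
C^(alpha + beta) (+) (C^m (x) C^(j1 + j2)) into two orthogonal pieces isometric
to the spaces on which g1 and g2 act, and let g act as g1 on the first piece
and as g2 on the second ([unitary_split]). As T commutes with the splitting of
the states, the loops of g1 and g2 placed side by side form a loop of g
([Char_dsum]).

Summands. Suppose that F = Theta g leaves the range of an isometry e invariant,
F e = e F1. Multiplying the loop of g by e on the right shows that g maps the
columns (e ; T X e) to (e F1 ; X e). Both lie in the subspace
W = (range of e) (+) (states), on which g need not act. However g is isometric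
on the subspace D of those w in W with g w in W. In finite dimension an
isometry from a subspace of W into W extends to a unitary operator of W
([isometry_extension], [unitary_compression]). The extension does not depend
on S, it keeps the space of states, and its loops at S are
(1 ; T X e) |-> (F1 ; X e), so that it realizes F1 ([Char_invariant]). A
summand of F is the case where e is a coordinate inclusion. *)

Set Implicit Arguments.
Unset Strict Implicit.
Unset Printing Implicit Defensive.

Import Order.TTheory GRing.Theory Num.Theory.

Local Open Scope ring_scope.
Local Open Scope complex_scope.
Local Open Scope sesquilinear_scope.

(** * Extending partial isometries to unitary matrices *)

Section Isometries.
Context {C : numClosedFieldType}.

Lemma adjmxM m n p (A : 'M[C]_(m, n)) (B : 'M[C]_(n, p)) :
  (A *m B)^t* = B^t* *m A^t*.
Proof. by rewrite trmx_mul map_mxM. Qed.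

Lemma adjmx1 n : (1%:M : 'M[C]_n)^t* = 1%:M.
Proof. by rewrite trmx1 map_mx1. Qed.

Lemma adjmx0 m n : (0 : 'M[C]_(m, n))^t* = 0.
Proof. by rewrite trmx0 map_mx0. Qed.

Lemma unitarymxPV n (g : 'M[C]_n) : g \is unitarymx -> g^t* *m g = 1%:M.
Proof. by move=> /unitarymxP /mulmx1C. Qed.

Lemma gram_isometry m n p (J : 'M[C]_(m, n)) (A : 'M[C]_(n, p)) :
  J^t* *m J = 1%:M -> (J *m A)^t* *m (J *m A) = A^t* *m A.
Proof. by move=> JJ; rewrite adjmxM mulmxA -[_ *m J]mulmxA JJ mulmx1. Qed.

Lemma mulmx_adj_eq0 m n (A : 'M[C]_(m, n)) : A *m A^t* = 0 -> A = 0.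
Proof.
move=> AA0; apply/row_matrixP => i; rewrite row0; apply/eqP.
rewrite -[_ == 0]negbK; apply/negP => /dotmx_is_dotmx; rewrite dotmxE.
suff -> : (row i A *m (row i A)^t*) 0 0 = (A *m A^t*) i i.
  by rewrite AA0 mxE ltxx.
by rewrite !mxE; apply: eq_bigr => k _; rewrite !mxE.
Qed.

(** Gram-Schmidt applied to a basis of the orthogonal complement of the rows
of Q, which is the row kernel of the adjoint of Q. *)
Lemma unitarymx_complete r n (Q : 'M[C]_(r, n)) : Q \is unitarymx ->
  exists N : 'M[C]_(n - r, n), col_mx Q N \is unitarymx.
Proof.
move=> Qu; suff [N NE] : exists N : 'M[C]_(\rank (kermx (Q^t*)), n),
    col_mx Q N \is unitarymx.
  have rE : \rank (kermx (Q^t*)) = (n - r)%N.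
    by rewrite mxrank_ker mxrank_map mxrank_tr mxrank_unitary.
  by case: _ / rE in N NE *; exists N.
exists (schmidt (row_base (kermx (Q^t*)))).
set N := schmidt _.
have Nu : N \is unitarymx by rewrite schmidt_unitarymx ?rank_leq_col.
have NQ : N *m Q^t* = 0.
  apply/sub_kermxP; rewrite /N (eqmx_schmidt_free (row_base_free _)).
  by rewrite eq_row_base.
have QN : Q *m N^t* = 0 by rewrite -[LHS]trmxCK adjmxM trmxCK NQ adjmx0.
apply/unitarymxP; rewrite tr_col_mx map_row_mx mul_col_row NQ QN.
by rewrite (unitarymxP Qu) (unitarymxP Nu) -scalar_mx_block.
Qed.

(** Equal Gram matrices mean that sending the rows of A to those of B is an
isometry between their spans. Expand A = D Q over an orthonormal basis Q of its
row space, with D of full column rank. Then B = D Q' for Q' := D^+ B, the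
Gram identity makes the rows of Q' orthonormal, and the unitary matrix carrying
a completion of Q to a completion of Q' carries A to B. *)
Lemma isometry_extension_row k n (A B : 'M[C]_(k, n)) :
  A *m A^t* = B *m B^t* ->
  exists2 U : 'M[C]_n, U \is unitarymx & A *m U = B.
Proof.
move=> AB; pose r := \rank A; pose Q : 'M[C]_(r, n) := schmidt (row_base A).
have Qu : Q \is unitarymx by rewrite schmidt_unitarymx ?rank_leq_col.
have [D AE] : exists D, A = D *m Q.
  by apply/submxP; rewrite (eqmx_schmidt_free (row_base_free _)) eq_row_base.
have DDE : D *m D^t* = B *m B^t*.
  by rewrite -AB AE adjmxM mulmxA mulmxtVK.
have Dfull : row_full D.
  by rewrite /row_full eqn_leq rank_leq_col /= -/r /r {1}AE mxrankM_maxl.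
have DK := mulVpmx Dfull.
pose Q' := pinvmx D *m B.
have BE : D *m Q' = B.
  (* D *m pinvmx D fixes D on the left, hence fixes every matrix with the same
     Gram matrix. *)
  apply/eqP; rewrite -subr_eq0; apply/eqP/mulmx_adj_eq0.
  have -> : D *m Q' - B = (D *m pinvmx D - 1%:M) *m B.
    by rewrite mulmxBl mul1mx mulmxA.
  rewrite adjmxM mulmxA -[_ *m B *m _]mulmxA -DDE mulmxA mulmxBl mul1mx.
  by rewrite -[D *m _ *m D]mulmxA DK mulmx1 subrr !mul0mx.
have Q'u : Q' \is unitarymx.
  apply/unitarymxP; rewrite adjmxM mulmxA -[_ *m B *m _]mulmxA -DDE.
  by rewrite mulmxA DK mul1mx -adjmxM DK adjmx1.
have [N Nu] := unitarymx_complete Qu; have [N' N'u] := unitarymx_complete Q'u.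
have rn : (r + (n - r))%N = n by rewrite subnKC ?rank_leq_col.
exists ((col_mx Q N)^t* *m col_mx Q' N').
  apply/unitarymxP; rewrite adjmxM mulmxA mulmxtVK // trmxCK.
  by rewrite -[_ *m _]mul1mx mulmxA mulmxKtV.
rewrite AE -mulmxA [Q *m _]mulmxA.
have /unitarymxP := Nu; rewrite tr_col_mx map_row_mx mul_col_row.
rewrite (@scalar_mx_block _ r (n - r)) => /eq_block_mx [QQ QN _ _].
by rewrite mul_mx_row mul_row_col QQ QN mul1mx mul0mx addr0.
Qed.

Lemma isometry_extension n k (A B : 'M[C]_(n, k)) :
  A^t* *m A = B^t* *m B ->
  exists2 U : 'M[C]_n, U \is unitarymx & U *m A = B.
Proof.
move=> AB; have [|U Uu UE] := @isometry_extension_row _ _ (A^t*) (B^t*).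
  by rewrite !trmxCK.
by exists (U^t*); rewrite ?trmxC_unitary // -[A]trmxCK -adjmxM UE trmxCK.
Qed.

(** With W the range of J, the columns of K span the w with g (J w) in W: this
is the kernel of the component of g J orthogonal to W. On them
[J^t* *m g *m J] is isometric, and g' extends it. *)
Lemma unitary_compression N n (g : 'M[C]_N) (J : 'M[C]_(N, n)) :
  g \is unitarymx -> J^t* *m J = 1%:M ->
  exists2 g' : 'M[C]_n, g' \is unitarymx &
    forall p (w w' : 'M[C]_(n, p)), g *m (J *m w) = J *m w' -> g' *m w = w'.
Proof.
move=> gu JJ; pose M := (1%:M - J *m J^t*) *m g *m J.
pose K := (kermx M^T)^T.
have MK : M *m K = 0 by apply: trmx_inj; rewrite trmx_mul trmxK mulmx_ker trmx0.
have JBE : J *m (J^t* *m g *m J *m K) = g *m J *m K.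
  by apply/esym/eqP; rewrite -subr_eq0 -MK /M !mulmxBl mul1mx !mulmxA.
have [|g' g'u g'E] := @isometry_extension _ _ K (J^t* *m g *m J *m K).
  (* J preserves Gram matrices, and so does g *m J. *)
  rewrite -[RHS](gram_isometry _ JJ) JBE -mulmxA.
  by rewrite (gram_isometry _ (unitarymxPV gu)) gram_isometry.
exists g' => // p w w' gw.
have [y wE] : exists y, w = K *m y.
  have /submxP [y yE] : (w^T <= kermx M^T)%MS.
    apply/sub_kermxP; rewrite -trmx_mul /M -!mulmxA gw mulmxBl mul1mx.
    by rewrite -mulmxA [J^t* *m _]mulmxA JJ mul1mx subrr trmx0.
  by exists y^T; rewrite -[w]trmxK yE trmx_mul.
by rewrite wE mulmxA g'E -!mulmxA -wE gw mulmxA JJ mul1mx.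
Qed.
End Isometries.

(** * Norm estimates and invertibility *)

Section Norms.
Context {R : realType}.
Local Notation C := R[i].

Lemma normc_ge0 (a : C) : 0 <= Normc.normc a.
Proof. by case: a => a b; exact: sqrtr_ge0. Qed.

Lemma enorm_ge0 n (x : 'cV[C]_n) : 0 <= enorm x.
Proof. exact: sqrtr_ge0. Qed.

Lemma enorm_sqr n (x : 'cV[C]_n) :
  enorm x ^+ 2 = \sum_i Normc.normc (x i 0) ^+ 2.
Proof. by rewrite sqr_sqrtr // sumr_ge0 // => i _; rewrite sqr_ge0. Qed.

Lemma enorm_sqrC n (x : 'cV[C]_n) : (enorm x ^+ 2)%:C = (x^t* *m x) 0 0.
Proof.
rewrite enorm_sqr rmorph_sum mxE; apply: eq_bigr => i _.
by rewrite !mxE rmorphXn mulrC -normCK.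
Qed.

Lemma enorm0_eq0 n (x : 'cV[C]_n) : enorm x = 0 -> x = 0.
Proof.
move=> x0; apply/colP => i; rewrite mxE; apply: Normc.eq0_normc.
have /eqP := enorm_sqr x; rewrite x0 expr0n eq_sym /= psumr_eq0; last first.
  by move=> k _; rewrite sqr_ge0.
by move=> /allP /(_ i (mem_index_enum i)); rewrite sqrf_eq0 => /eqP.
Qed.

Lemma enorm_isometry m n (J : 'M[C]_(m, n)) (x : 'cV[C]_n) :
  J^t* *m J = 1%:M -> enorm (J *m x) = enorm x.
Proof.
move=> JJ; apply/eqP; rewrite -(eqrXn2 (ltn0Sn 1)) ?enorm_ge0 //; apply/eqP.
by apply: (@complexI R); rewrite !enorm_sqrC gram_isometry.
Qed.

Lemma enorm_col_mx m n (x : 'cV[C]_m) (y : 'cV[C]_n) :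
  enorm (col_mx x y) ^+ 2 = enorm x ^+ 2 + enorm y ^+ 2.
Proof.
rewrite !enorm_sqr big_split_ord /=; congr (_ + _); apply: eq_bigr => i _.
  by rewrite col_mxEu.
by rewrite col_mxEd.
Qed.

Lemma enorm_drsubmx m n (g : 'M[C]_(m + n)) (y : 'cV[C]_n) :
  g \is unitarymx -> enorm (drsubmx g *m y) <= enorm y.
Proof.
move=> /unitarymxPV gu; rewrite -(ler_pXn2r (ltn0Sn 1)) ?nnegrE ?enorm_ge0 //.
have := enorm_isometry (col_mx 0 y) gu.
move=> /(congr1 (fun r => r ^+ 2)); rewrite -{1}[g]submxK mul_block_col.
rewrite !mulmx0 !add0r !enorm_col_mx.
have -> : enorm (0 : 'cV[C]_m) ^+ 2 = 0.
  by rewrite enorm_sqr big1 // => i _; rewrite mxE Normc.normc0 expr0n.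
by rewrite add0r => <-; rewrite lerDr sqr_ge0.
Qed.

Lemma enormZ n (a : R) (x : 'cV[C]_n) : 0 <= a ->
  enorm (a%:C *: x) = a * enorm x.
Proof.
move=> a0; apply/eqP; rewrite -(eqrXn2 (ltn0Sn 1)) ?mulr_ge0 ?enorm_ge0 //.
rewrite exprMn !enorm_sqr mulr_sumr; apply/eqP/eq_bigr => i _.
rewrite mxE Normc.normcM exprMn; congr (_ ^+ 2 * _).
by rewrite /Normc.normc /= expr0n addr0 sqrtr_sqr ger0_norm.
Qed.

(** The supremum of an unbounded set of reals is 0 by convention, so that
[opnorm] dominates the values [enorm (z *m x)] only once they are bounded. *)
Lemma opnorm_has_sup n (z : 'M[C]_n) :
  has_sup [set enorm (z *m x) | x in [set x : 'cV[C]_n | enorm x <= 1]]%classic.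
Proof.
split.
  exists (enorm (z *m 0)); exists 0 => //=.
  rewrite /enorm big1 ?sqrtr0 ?ler01 //.
  by move=> i _; rewrite mxE Normc.normc0 expr0n.
exists (Num.sqrt (\sum_i (\sum_k Normc.normc (z i k)) ^+ 2)) => _ [x /= x1 <-].
have xk k : Normc.normc (x k 0) <= 1.
  rewrite -(ler_pXn2r (ltn0Sn 1)) ?nnegrE ?normc_ge0 // expr1n.
  apply: (@le_trans _ _ (enorm x ^+ 2)); last by rewrite exprn_ile1 ?enorm_ge0.
  rewrite enorm_sqr (bigD1 k) //= lerDl sumr_ge0 // => j _.
  by rewrite sqr_ge0.
apply: ler_wsqrtr; apply: ler_sum => i _.
rewrite ler_pXn2r ?nnegrE ?normc_ge0 ?sumr_ge0 //; last first.
  by move=> k _; exact: normc_ge0.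
have normcE (a : C) : (Normc.normc a)%:C = `|a| by [].
rewrite -lecR mxE normcE; apply: (le_trans (ler_norm_sum _ _ _)).
rewrite rmorph_sum; apply: ler_sum => k _.
by rewrite normrM ler_piMr ?normr_ge0 // lecR.
Qed.

Lemma enorm_mulmx_le n (z : 'M[C]_n) (x : 'cV[C]_n) :
  enorm (z *m x) <= opnorm z * enorm x.
Proof.
have [x0|x_neq0] := eqVneq (enorm x) 0.
  by rewrite x0 mulr0 (enorm0_eq0 x0) mulmx0 -x0 (enorm0_eq0 x0).
have x_gt0 : 0 < enorm x by rewrite lt_def x_neq0 enorm_ge0.
rewrite -ler_pdivrMr // mulrC -enormZ ?invr_ge0 ?enorm_ge0 // scalemxAr.
apply: (ub_le_sup (opnorm_has_sup z).2); exists ((enorm x)^-1%:C *: x) => //=.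
by rewrite enormZ ?invr_ge0 ?enorm_ge0 // mulVf.
Qed.

Lemma opnorm_ge0 n (z : 'M[C]_n) : 0 <= opnorm z.
Proof.
have [[_ [x x1 _]] ub] := opnorm_has_sup z.
by apply: (le_trans (enorm_ge0 (z *m x))); apply: (ub_le_sup ub); exists x.
Qed.

Lemma sum_mxtens (V : nmodType) m j (f : 'I_(m * j) -> V) :
  \sum_k f k = \sum_(l < j) \sum_(i < m) f (mxtens_index (i, l)).
Proof.
rewrite (reindex (@mxtens_index m j)) /=; last first.
  exists (@mxtens_unindex m j) => i _;
    by rewrite ?mxtens_indexK ?mxtens_unindexK.
by rewrite exchange_big pair_big; apply: eq_bigr => -[].
Qed.

(** For each l < j, the coordinates of index (i, l) form a vector of C^m; on
these slices S (x) 1_j acts by S separately. *)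
Lemma enorm_tens_le m j (S : 'M[C]_m) (x : 'cV[C]_(m * j)) :
  enorm ((S *t (1%:M : 'M[C]_j)) *m x) <= opnorm S * enorm x.
Proof.
pose slice (y : 'cV[C]_(m * j)) l :=
  \col_(i < m) y (mxtens_index (i, l)) 0.
have enorm_slice y : enorm y ^+ 2 = \sum_l enorm (slice y l) ^+ 2.
  rewrite enorm_sqr sum_mxtens; apply: eq_bigr => l _.
  by rewrite enorm_sqr; apply: eq_bigr => i _; rewrite mxE.
have sliceM l : slice ((S *t 1%:M) *m x) l = S *m slice x l.
  apply/colP => i; rewrite !mxE sum_mxtens (bigD1 l) //= [X in _ + X]big1.
    by rewrite addr0; apply: eq_bigr => k _; rewrite tensmxE !mxE eqxx mulr1.
  move=> l' l'l; apply: big1 => k _.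
  by rewrite tensmxE !mxE eq_sym (negPf l'l) mulr0 mul0r.
rewrite -(ler_pXn2r (ltn0Sn 1)) ?nnegrE ?mulr_ge0 ?opnorm_ge0 ?enorm_ge0 //.
rewrite exprMn !enorm_slice mulr_sumr; apply: ler_sum => l _.
rewrite sliceM -exprMn ler_pXn2r ?nnegrE ?mulr_ge0 ?opnorm_ge0 ?enorm_ge0 //.
exact: enorm_mulmx_le.
Qed.

(** A kernel vector satisfies x = d T x, whence |x| <= |S| |x| with
|S| < 1. *)
Lemma unitmx_feedback m alpha j (g : 'M[C]_(alpha + m * j)) (S : 'M[C]_m) :
  g \is unitarymx -> oball S ->
  1%:M - drsubmx g *m (S *t (1%:M : 'M[C]_j)) \in unitmx.
Proof.
move=> gu S1; set T := S *t _.
rewrite -unitmx_tr -row_free_unit; apply: inj_row_free => v.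
move=> /(congr1 trmx); rewrite trmx_mul trmxK trmx0 mulmxBl mul1mx => /eqP.
rewrite subr_eq0 -mulmxA => /eqP xE; apply: trmx_inj; rewrite trmx0.
apply: enorm0_eq0; apply/eqP; rewrite eq_le enorm_ge0 andbT.
have le_x : enorm v^T <= opnorm S * enorm v^T.
  rewrite {1}xE; apply: (le_trans (enorm_drsubmx _ gu)).
  exact: enorm_tens_le.
by rewrite -(pmulr_rle0 (x := 1 - opnorm S)) ?subr_gt0 // mulrBl mul1r subr_le0.
Qed.
End Norms.

(** * Characteristic functions as feedback loops *)

Section Theta.
Context {R : realType} (m : nat).
Local Notation C := R[i].

(** The state of the loop is (1 - d T)^-1 c. *)
Lemma Theta_graph_ex alpha j (g : 'M[C]_(alpha + m * j)) (S : 'M[C]_m) :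
  g \is unitarymx -> oball S ->
  exists X, g *m col_mx 1%:M ((S *t 1%:M) *m X) = col_mx (Theta g S) X.
Proof.
move=> gu S1; have := unitmx_feedback gu S1; rewrite /Theta.
set T := S *t _ => Mu; set M := _ - _ in Mu *.
pose X := invmx M *m dlsubmx g; exists X.
have XE : X - drsubmx g *m (T *m X) = dlsubmx g.
  by rewrite -[RHS](mulKVmx Mu) mulmxBl mul1mx !mulmxA.
rewrite -{1}[g]submxK mul_block_col !mulmx1; congr col_mx.
  by rewrite !mulmxA.
by rewrite -{1}XE subrK.
Qed.

Lemma Theta_graph_eq alpha j (g : 'M[C]_(alpha + m * j)) (S : 'M[C]_m) X Y :
  g \is unitarymx -> oball S ->
  g *m col_mx 1%:M ((S *t 1%:M) *m X) = col_mx Y X -> Y = Theta g S.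
Proof.
move=> gu S1; have := unitmx_feedback gu S1; rewrite /Theta.
set T := S *t _ => Mu.
rewrite -{1}[g]submxK mul_block_col !mulmx1 => /eq_col_mx [<- XE].
suff <- : invmx (1%:M - drsubmx g *m T) *m dlsubmx g = X by rewrite !mulmxA.
rewrite -[RHS](mulKmx Mu); congr (_ *m _).
by rewrite mulmxBl mul1mx -{1}XE mulmxA addrK.
Qed.

(** The summand half of the theorem, for any isometry e whose range is
invariant under every F S; the space of states, hence j, stays the same. *)
Lemma Char_invariant alpha gamma (e : 'M[C]_(gamma, alpha)) F F1 :
  e^t* *m e = 1%:M -> Char F ->
  (forall S : 'M[C]_m, oball S -> F S *m e = e *m F1 S) -> Char F1.
Proof.
move=> ee [j [g [gu FE]]] Fe; exists j.
pose J : 'M[C]_(gamma + m * j, alpha + m * j) := block_mx e 0 0 1%:M.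
have JJ : J^t* *m J = 1%:M.
  rewrite tr_block_mx map_block_mx mulmx_block !adjmx0 adjmx1 ee.
  by rewrite !mulmx0 !mul0mx mulmx1 !addr0 add0r -scalar_mx_block.
have [g' g'u g'E] := unitary_compression gu JJ.
exists g'; split=> // S S1; have [X gX] := Theta_graph_ex gu S1.
apply: (@Theta_graph_eq _ _ _ _ (X *m e)) => //; apply: g'E.
rewrite !mul_block_col !mul0mx !mul1mx mulmx1 !addr0 !add0r.
rewrite -Fe // FE // -mul_col_mx -gX -mulmxA mul_col_mx mul1mx.
by rewrite mulmxA.
Qed.

(** * Orthogonal direct sums *)

(** C^n is the orthogonal sum of the ranges of the isometries J1 and J2. Using
isometries rather than blocks spares casts between m * (j1 + j2) and
m * j1 + m * j2. *)
Definition orthogonal_split m1 m2 n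
    (J1 : 'M[C]_(n, m1)) (J2 : 'M[C]_(n, m2)) : Prop :=
  [/\ J1^t* *m J1 = 1%:M, J2^t* *m J2 = 1%:M, J1^t* *m J2 = 0
    & J1 *m J1^t* + J2 *m J2^t* = 1%:M].

Definition inl_mx p q : 'M[C]_(p + q, p) := col_mx 1%:M 0.
Definition inr_mx p q : 'M[C]_(p + q, q) := col_mx 0 1%:M.

Lemma orthogonal_split_inl_inr p q :
  orthogonal_split (inl_mx p q) (inr_mx p q).
Proof.
rewrite /orthogonal_split !tr_col_mx !map_row_mx !adjmx1 !adjmx0.
split; rewrite ?mul_row_col ?mul_col_row ?mulmx1 ?mul1mx ?mulmx0 ?mul0mx;
  rewrite ?addr0 ?add0r //.
by rewrite add_block_mx !addr0 !add0r -scalar_mx_block.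
Qed.

Lemma tens1mx1 k n : (1%:M : 'M[C]_k) *t (1%:M : 'M[C]_n) = 1%:M.
Proof.
apply/matrixP => a b.
case: (mxtens_indexP a) => i j; case: (mxtens_indexP b) => i' j'.
by rewrite tensmxE !mxE -natrM mulnb (can_eq (@mxtens_indexK _ _)) xpair_eqE.
Qed.

Lemma adj_tens1mx k n p (A : 'M[C]_(n, p)) :
  ((1%:M : 'M[C]_k) *t A)^t* = 1%:M *t A^t*.
Proof. by rewrite trmx_tens map_mxT adjmx1. Qed.

Lemma orthogonal_split_tens k m1 m2 n
    (J1 : 'M[C]_(n, m1)) (J2 : 'M[C]_(n, m2)) :
  orthogonal_split J1 J2 ->
  orthogonal_split ((1%:M : 'M[C]_k) *t J1) ((1%:M : 'M[C]_k) *t J2).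
Proof.
case=> J11 J22 J12 JJ; rewrite /orthogonal_split !adj_tens1mx !tensmx_mul.
rewrite !mulmx1 J11 J22 J12 !tens1mx1 tensmx0; split=> //.
rewrite -tens1mx1 -JJ; apply/matrixP => a b; rewrite [LHS]mxE !mxE.
by rewrite mulrDr.
Qed.

Lemma orthogonal_split_block p1 p2 p q1 q2 q
    (J1 : 'M[C]_(p, p1)) (J2 : 'M[C]_(p, p2))
    (K1 : 'M[C]_(q, q1)) (K2 : 'M[C]_(q, q2)) :
  orthogonal_split J1 J2 -> orthogonal_split K1 K2 ->
  orthogonal_split (block_mx J1 0 0 K1) (block_mx J2 0 0 K2).
Proof.
case=> J11 J22 J12 JJ [K11 K22 K12 KK].
rewrite /orthogonal_split !tr_block_mx !map_block_mx !adjmx0 !mulmx_block.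
rewrite !mulmx0 !mul0mx !addr0 !add0r J11 J22 J12 K11 K22 K12.
by rewrite add_block_mx JJ KK !addr0 -!scalar_mx_block block_mx_const.
Qed.

Lemma unitary_split m1 m2 n (J1 : 'M[C]_(n, m1)) (J2 : 'M[C]_(n, m2)) g1 g2 :
  orthogonal_split J1 J2 -> g1 \is unitarymx -> g2 \is unitarymx ->
  exists g : 'M[C]_n,
    [/\ g \is unitarymx, g *m J1 = J1 *m g1 & g *m J2 = J2 *m g2].
Proof.
move=> [J11 J22 J12 JJ] gu1 gu2.
have J21 : J2^t* *m J1 = 0 by rewrite -[LHS]trmxCK adjmxM trmxCK J12 adjmx0.
pose g := J1 *m g1 *m J1^t* + J2 *m g2 *m J2^t*.
have gJ1 : g *m J1 = J1 *m g1.
  by rewrite mulmxDl -!mulmxA J11 J21 !mulmx0 !mulmx1 addr0.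
have gJ2 : g *m J2 = J2 *m g2.
  by rewrite mulmxDl -!mulmxA J12 J22 !mulmx0 !mulmx1 add0r.
exists g; split=> //; apply/unitarymxP.
have -> : g^t* = J1 *m g1^t* *m J1^t* + J2 *m g2^t* *m J2^t*.
  by rewrite linearD map_mxD !adjmxM !trmxCK !mulmxA.
by rewrite mulmxDr !mulmxA gJ1 gJ2 !mulmxtVK.
Qed.

Lemma Char_dsum alpha beta (F1 : 'M[C]_m -> 'M[C]_alpha)
    (F2 : 'M[C]_m -> 'M[C]_beta) :
  Char F1 -> Char F2 -> Char (dsum F1 F2).
Proof.
move=> [j1 [g1 [gu1 FE1]]] [j2 [g2 [gu2 FE2]]]; exists (j1 + j2)%N.
pose e1 := inl_mx alpha beta; pose e2 := inr_mx alpha beta.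
pose V1 := (1%:M : 'M[C]_m) *t inl_mx j1 j2.
pose V2 := (1%:M : 'M[C]_m) *t inr_mx j1 j2.
(* Tensoring the inclusions C^ji -> C^(j1 + j2) by 1_m splits the states in a
   way that commutes with S (x) 1. *)
have [|g [gu gJ1 gJ2]] := @unitary_split _ _ _
    (block_mx e1 0 0 V1) (block_mx e2 0 0 V2) g1 g2 _ gu1 gu2.
  apply: orthogonal_split_block; first exact: orthogonal_split_inl_inr.
  exact/orthogonal_split_tens/orthogonal_split_inl_inr.
exists g; split=> // S S1; rewrite /dsum FE1 // FE2 //.
have [X1 gX1] := Theta_graph_ex gu1 S1; have [X2 gX2] := Theta_graph_ex gu2 S1.
apply: (@Theta_graph_eq _ _ _ _ (row_mx (V1 *m X1) (V2 *m X2))) => //.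
have TV j k (J : 'M[C]_(j, k)) :
    (S *t 1%:M) *m (1%:M *t J) = (1%:M *t J) *m (S *t 1%:M).
  by rewrite !tensmx_mul !mulmx1 !mul1mx.
have JE p q k (e : 'M[C]_(alpha + beta, p)) (V : 'M[C]_(m * (j1 + j2), q))
    (A : 'M[C]_(p, k)) (B : 'M[C]_(q, k)) :
    block_mx e 0 0 V *m col_mx A B = col_mx (e *m A) (V *m B).
  by rewrite mul_block_col !mul0mx addr0 add0r.
have eE (A : 'M[C]_alpha) (B : 'M[C]_beta) :
    block_mx A 0 0 B = row_mx (e1 *m A) (e2 *m B).
  by rewrite !mul_col_mx !mul1mx !mul0mx -block_mxEh.
rewrite scalar_mx_block !eE mul_mx_row !mulmxA !TV -!mulmxA -!block_mxEv.
by rewrite !block_mxEh -!JE mul_mx_row !mulmxA gJ1 gJ2 -!mulmxA gX1 gX2.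
Qed.

End Theta.

(** * Direct sums and summands *)

Theorem theorem1p2 (R : realType) (m alpha beta : nat)
    (hm : (0 < m)%N) (halpha : (0 < alpha)%N) (hbeta : (0 < beta)%N) :
  (forall (F1 : 'M[R[i]]_m -> 'M[R[i]]_alpha)
          (F2 : 'M[R[i]]_m -> 'M[R[i]]_beta),
     Char F1 -> Char F2 -> Char (dsum F1 F2)) /\
  (forall (F : 'M[R[i]]_m -> 'M[R[i]]_(alpha + beta))
          (F1 : 'M[R[i]]_m -> 'M[R[i]]_alpha)
          (F2 : 'M[R[i]]_m -> 'M[R[i]]_beta),
     Char F -> Inn F1 -> Inn F2 ->
     (forall S, oball S -> F S = dsum F1 F2 S) ->
     Char F1 /\ Char F2).
Proof.
split=> [F1 F2|F F1 F2 charF _ _ FE]; first exact: Char_dsum.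
have [inl1 inr1 _ _] := @orthogonal_split_inl_inr R alpha beta.
split.
  apply: (Char_invariant inl1 charF) => S S1.
  rewrite FE // mul_block_col mul_col_mx !mulmx1 !mulmx0 !mul0mx mul1mx.
  by rewrite !addr0.
apply: (Char_invariant inr1 charF) => S S1.
rewrite FE // mul_block_col mul_col_mx !mulmx1 !mulmx0 !mul0mx mul1mx.
by rewrite !add0r.
Qed.
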